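(* Let $S=\langle n_1,n_2,n_3,n_4\rangle$ be an almost symmetric numerical semigroup with embedding dimension four and type three, and assume that $n_1,n_2,n_3,n_4$ are all odd. Then $\mathrm{PF}(S)=\{f,2f,3f\}$ for some positive integer $f$, and, after a suitable reordering of $n_1,n_2,n_3,n_4$, there exist RF-matrices of $f$ and of $2f$ of the form $$\mathrm{RF}(f)=\begin{pmatrix} -1 & \alpha_2-1 & 0 & 0\\ 0 & -1 & \alpha_3-1 & 0\\ 0&0&-1&\alpha_4-1\\ \alpha_1-1 & 0&0&-1\end{pmatrix},\qquad \mathrm{RF}(2f)=\begin{pmatrix} -1 & \alpha_2-2 & \alpha_3-1 & 0\\ 0 & -1 & \alpha_3-2 & \alpha_4-1\\ \alpha_1-1&0&-1&\alpha_4-2\\ \alpha_1-2 & \alpha_2-1&0&-1\end{pmatrix}.$$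
   Context: For a numerical semigroup $S$ minimally generated by $n_1,\dots,n_4$: $F(S)=\max(\mathbb{Z}\setminus S)$; $\mathrm{PF}(S)$ is the set of integers $f\notin S$ with $f+s\in S$ for all $s\in S\setminus\{0\}$; the type is $t(S)=|\mathrm{PF}(S)|$; $g(S)=|\mathbb{N}\setminus S|$; $S$ is almost symmetric if $2g(S)=F(S)+t(S)$. $\alpha_i$ is the least positive integer such that $\alpha_in_i$ is a non-negative integer combination of the $n_j$, $j\neq i$. An RF-matrix of $f\in\mathrm{PF}(S)$ is a $4\times 4$ integer matrix $(a_{ij})$ with $a_{ii}=-1$, $a_{ij}\ge0$ for $i\ne j$, and $f=\sum_{j}a_{ij}n_j$ for every $i$. *)

(* Defs.v *)
From HB Require Import structures.
From mathcomp Require Import all_boot all_order all_algebra all_fingroup.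
Set Implicit Arguments. Unset Strict Implicit. Unset Printing Implicit Defensive.
Import Order.TTheory GRing.Theory Num.Theory.
Local Open Scope ring_scope.

Definition inS (n : 'I_4 -> nat) (x : int) : Prop :=
  exists c : 'I_4 -> nat, x = ((\sum_(j < 4) c j * n j)%N)%:Z.

Definition inS_without (n : 'I_4 -> nat) (i : 'I_4) (x : int) : Prop :=
  exists c : 'I_4 -> nat, c i = 0%N /\ x = ((\sum_(j < 4) c j * n j)%N)%:Z.

Definition min_gen4_numsgp (n : 'I_4 -> nat) : Prop :=
  (\big[gcdn/0%N]_(j < 4) n j)%N = 1%N /\
  forall i : 'I_4, ~ inS_without n i (n i)%:Z.

Definition is_alpha (n : 'I_4 -> nat) (i : 'I_4) (a : nat) : Prop :=
  (0 < a)%N /\ inS_without n i (a * n i)%N%:Z /\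
  forall b : nat, (0 < b)%N -> (b < a)%N -> ~ inS_without n i (b * n i)%N%:Z.

Definition isPF (n : 'I_4 -> nat) (f : int) : Prop :=
  ~ inS n f /\ forall s : int, inS n s -> s <> 0 -> inS n (f + s).

Definition isFrobenius (n : 'I_4 -> nat) (F : int) : Prop :=
  ~ inS n F /\ forall x : int, F < x -> inS n x.

Definition has_genus (n : 'I_4 -> nat) (g : nat) : Prop :=
  exists gs : seq nat, uniq gs /\ size gs = g /\
    forall x : nat, x \in gs <-> ~ inS n x%:Z.

Definition has_type (n : 'I_4 -> nat) (t : nat) : Prop :=
  exists ps : seq int, uniq ps /\ size ps = t /\
    forall x : int, x \in ps <-> isPF n x.

Definition almost_symmetric (n : 'I_4 -> nat) : Prop :=
  exists (F : int) (g t : nat),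
    isFrobenius n F /\ has_genus n g /\ has_type n t /\
    2 * g%:Z = F + t%:Z.

Definition isRFmatrix (n : 'I_4 -> nat) (f : int) (M : 'M[int]_4) : Prop :=
  forall i : 'I_4,
    M i i = -1 /\
    (forall j : 'I_4, j != i -> 0 <= M i j) /\
    f = \sum_(j < 4) M i j * (n j)%:Z.

Definition mx_of_rows (r : seq (seq int)) : 'M[int]_4 :=
  \matrix_(i < 4, j < 4) nth 0 (nth [::] r i) j.

Definition RF1 (a : 'I_4 -> nat) : 'M[int]_4 :=
  let a k := (a (inord k))%:Z in
  mx_of_rows
   [:: [:: -1; a 1%N - 1; 0; 0];
       [:: 0; -1; a 2%N - 1; 0];
       [:: 0; 0; -1; a 3%N - 1];
       [:: a 0%N - 1; 0; 0; -1]].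

Definition RF2 (a : 'I_4 -> nat) : 'M[int]_4 :=
  let a k := (a (inord k))%:Z in
  mx_of_rows
   [:: [:: -1; a 1%N - 2; a 2%N - 1; 0];
       [:: 0; -1; a 2%N - 2; a 3%N - 1];
       [:: a 0%N - 1; 0; -1; a 3%N - 2];
       [:: a 0%N - 2; a 1%N - 1; 0; -1]].

(* Main.v *)
(* Write [S] for the semigroup and [F] for its Frobenius number.  Counting gaps
   shows that PF(S) = {f_1, f_0, F} with f_1 + f_0 = F, and that [x] or [F - x]
   lies in [S] for all integers [x] but f_1 and f_0.  Taking x = F/2 shows that
   [F] is odd, so f_b may be taken to have parity [b].

   Let E_b be the digraph on the four generators with an edge from [i] to [j] if
   f_b + n_i - n_j lies in [S]; for i <> j exactly one of i -> j in E_b and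
   j -> i in E_(1-b) holds.  Call an edge i -> j sole if [j] is the only
   successor of [i].  Then f_b + n_i = (alpha_j - 1) n_j, so that alpha_j has
   parity [b], and each [j] is the target of at most one sole edge of E_0 and E_1
   together.  The eight out-degrees are positive and add up to twelve, so at
   least four of them are one.  Hence each vertex is the target of exactly one
   sole edge, and the other out-degrees are two.

   A sole edge of E_1 is never followed by one of E_0 (F + n_i would have both
   an even factorization and a reduced one with an odd coefficient), and two
   sole edges never form a 2-cycle (by congruences modulo gcd(n_i, n_j)).
   Following sole edges backwards thus leads to a 4-cycle in some E_b, which
   forces f_(1-b) = 2 f_b, hence b = 1, and displays both RF-matrices. *)

Require Import Defs.
From HB Require Import structures.
From mathcomp Require Import all_boot all_order all_algebra all_fingroup.
From mathcomp Require Import zify.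
Import Order.TTheory GRing.Theory Num.Theory.
Local Open Scope ring_scope.

Set Implicit Arguments.
Unset Strict Implicit.
Unset Printing Implicit Defensive.

Ltac distinct4 := repeat match goal with
  | H : is_true (uniq _) |- _ => revert H
  | H : is_true (_ \notin [:: _, _ & _]) |- _ => revert H
  | H : is_true (_ != _) |- _ => revert H
  end; rewrite /= ?inE -?val_eqE /=; lia.

Lemma exists_notin_seq (T : finType) (s : seq T) :
  (size s < #|T|)%N -> exists x, x \notin s.
Proof.
move=> lt_s; apply/existsP; apply: contraLR lt_s => /existsPn all_s.
rewrite -leqNgt; apply: leq_trans (card_size s); apply/subset_leq_card/subsetP.
by move=> x _; move: (all_s x); rewrite negbK.
Qed.

Lemma uniq3_extend (i j k : 'I_4) :
  uniq [:: i; j; k] -> exists l, uniq [:: i; j; k; l].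
Proof.
move=> Uq; have [|l l_notin] := @exists_notin_seq _ [:: i; j; k].
  by rewrite card_ord.
by exists l; distinct4.
Qed.

Lemma uniq2_extend (i j : 'I_4) : i != j -> exists k l, uniq [:: i; j; k; l].
Proof.
move=> ij; have [|k k_notin] := @exists_notin_seq _ [:: i; j].
  by rewrite card_ord.
have [|l Uq] := @uniq3_extend i j k; first by distinct4.
by exists k, l.
Qed.

Lemma perm_enum_ord4 (i j k l : 'I_4) :
  uniq [:: i; j; k; l] -> perm_eq (index_enum 'I_4) [:: i; j; k; l].
Proof.
move=> Uq; rewrite perm_sym uniq_perm ?index_enum_uniq // => x.
have sub : {subset [:: i; j; k; l] <= index_enum 'I_4}.
  by move=> y _; rewrite mem_index_enum.
have [] // := uniq_min_size Uq sub.
by rewrite /index_enum -enumT size_enum_ord.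
Qed.

Lemma uniq4_mem (i j k l x : 'I_4) :
  uniq [:: i; j; k; l] -> x \in [:: i; j; k; l].
Proof. by move/perm_enum_ord4/perm_mem <-; rewrite mem_index_enum. Qed.

Lemma uniq4_sum (V : nmodType) (i j k l : 'I_4) (v : 'I_4 -> V) :
  uniq [:: i; j; k; l] -> \sum_(x < 4) v x = v i + v j + v k + v l.
Proof.
by move=> Uq; rewrite (perm_big _ (perm_enum_ord4 Uq)) unlock /= addr0 !addrA.
Qed.

Definition sole_edge (T : finType) (e : rel T) (i j : T) : bool :=
  [forall k, e i k == (k == j)].

Lemma sole_edgeE (T : finType) (e : rel T) (i j k : T) :
  sole_edge e i j -> e i k = (k == j).
Proof. by move=> /forallP/(_ k)/eqP. Qed.

Lemma sole_edge_out (T : finType) (e : rel T) (i j j' : T) :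
  sole_edge e i j -> sole_edge e i j' -> j = j'.
Proof.
by move=> sij sij'; apply/eqP; rewrite -(sole_edgeE _ sij') (sole_edgeE _ sij).
Qed.

Lemma sole_edge_source_neq (T : finType) (e : rel T) (i i' j j' : T) :
  sole_edge e i j -> sole_edge e i' j' -> j != j' -> i != i'.
Proof.
move=> sij si'j'; apply: contraNneq => ii'; apply/eqP.
by move: si'j'; rewrite -ii'; apply: sole_edge_out.
Qed.

Lemma card1_sole_edge (T : finType) (e : rel T) (i : T) :
  #|e i| = 1%N -> exists j, sole_edge e i j.
Proof.
by move/mem_card1 => [j ej]; exists j; apply/forallP => k; apply/eqP/ej.
Qed.

Definition sole_2cycle (T : finType) (e : rel T) (i j : T) : bool :=
  sole_edge e i j && sole_edge e j i.

Lemma sole_2cycleC (T : finType) (e : rel T) (i j : T) :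
  sole_2cycle e i j = sole_2cycle e j i.
Proof. exact: andbC. Qed.

Definition sole_4cycle (T : finType) (e : rel T) (i j k l : T) : Prop :=
  uniq [:: i; j; k; l] /\
  [/\ sole_edge e i j, sole_edge e j k, sole_edge e k l & sole_edge e l i].

Lemma sole_4cycle_rot (T : finType) (e : rel T) (i j k l : T) :
  sole_4cycle e i j k l -> sole_4cycle e j k l i.
Proof. by rewrite /sole_4cycle -(rot_uniq 1 [:: i; j; k; l]) => -[? []]. Qed.

Definition dual_digraphs (E : bool -> rel 'I_4) : Prop :=
  [/\ forall b, irreflexive (E b),
      forall b i j, i != j -> E (~~ b) j i = ~~ E b i j,
      forall b i, exists j, E b i j
    & forall b b' i i' j,
        sole_edge (E b) i j -> sole_edge (E b') i' j -> b = b' /\ i = i'].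

Section DualDigraphs.

Variable E : bool -> rel 'I_4.
Hypothesis dual_E : dual_digraphs E.

Implicit Types (b : bool) (i j k l : 'I_4).

Let E_irr b i : E b i i = false.
Proof. by case: dual_E => + _ _ _; apply. Qed.

Let E_dual b i j : i != j -> E (~~ b) j i = ~~ E b i j.
Proof. by case: dual_E => _ + _ _; apply. Qed.

Lemma sole_edge_neq b i j : sole_edge (E b) i j -> i != j.
Proof. by move=> sij; rewrite -(sole_edgeE _ sij) E_irr. Qed.

Lemma sum_outdeg : (\sum_(p : bool * 'I_4) #|E p.1 p.2| = 12)%N.
Proof.
have cardE b i : #|E b i| = (\sum_j E b i j)%N.
  rewrite -sum1_card big_mkcond; apply: eq_bigr => j _.
  by rewrite unfold_in; case: ifP.
rewrite -(pair_bigA _ (fun b i => #|E b i|)) big_bool /=.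
rewrite (eq_bigr _ (fun i _ => cardE false i)) exchange_big -big_split /=.
rewrite (eq_bigr (fun=> 3%N)) ?sum_nat_const ?card_ord // => i _.
rewrite cardE -big_split (bigD1 i) //= !E_irr (eq_bigr (fun=> 1%N)) => [|j ji].
  by rewrite sum1_card cardC1 card_ord.
by rewrite (E_dual true) 1?eq_sym //; case: E.
Qed.

Lemma sum_sole_in_le1 j :
  (\sum_(p : bool * 'I_4) sole_edge (E p.1) p.2 j <= 1)%N.
Proof.
case: (pickP (fun p : bool * 'I_4 => sole_edge (E p.1) p.2 j)) => [p sp|no].
  rewrite (bigD1 p) //= sp big1 // => q; apply: contraNeq.
  case: p q sp => [b i] [b' i'] /= sij; rewrite eqb0 negbK => sij'.
  have [_ _ _ sole_inj] := dual_E.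
  by have [-> ->] := sole_inj _ _ _ _ _ sij' sij.
by rewrite big1 // => p _; rewrite (no p).
Qed.

Lemma sum_outdeg_sole_le :
  (\sum_(p : bool * 'I_4) (#|E p.1 p.2| + (#|E p.1 p.2| == 1))
     <= 12 + \sum_j \sum_(p : bool * 'I_4) sole_edge (E p.1) p.2 j)%N.
Proof.
rewrite big_split sum_outdeg leq_add2l exchange_big; apply: leq_sum => p _.
case: eqP => // /card1_sole_edge[j spj].
by rewrite (bigD1 j) //= spj.
Qed.

Lemma outdeg_sole_ge2 b i : (2 <= #|E b i| + (#|E b i| == 1))%N.
Proof.
have : (0 < #|E b i|)%N.
  by have [_ _ /(_ b i)[j Eij] _] := dual_E; apply/card_gt0P; exists j.
by case: #|_| => [|[|m]].
Qed.

Lemma sole_edge_into j : exists b i, sole_edge (E b) i j.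
Proof.
case: (pickP (fun p : bool * 'I_4 => sole_edge (E p.1) p.2 j)) => [p sp|no].
  by exists p.1, p.2.
suff : (16 <= 12 + 3)%N by [].
have -> : 16%N = (\sum_(p : bool * 'I_4) 2)%N.
  by rewrite sum_nat_const card_prod card_bool card_ord.
apply: leq_trans (leq_sum _ (fun p _ => outdeg_sole_ge2 p.1 p.2)) _.
apply: leq_trans sum_outdeg_sole_le _; rewrite leq_add2l.
rewrite (bigD1 j) //= [X in (X + _)%N]big1 => [|p _]; last by rewrite (no p).
apply: leq_trans (leq_sum _ (fun k _ => sum_sole_in_le1 k)) _.
by rewrite sum1_card cardC1 card_ord.
Qed.

Lemma outdeg_le2 b i : (#|E b i| <= 2)%N.
Proof.
rewrite leqNgt; apply/negP => deg_gt2.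
suff : (3 + 14 <= 12 + 4)%N by [].
apply: leq_trans (leq_trans sum_outdeg_sole_le _); last first.
  rewrite leq_add2l.
  apply: leq_trans (leq_sum _ (fun k _ => sum_sole_in_le1 k)) _.
  by rewrite sum1_card card_ord.
rewrite (bigD1 (b, i)) //= leq_add ?(leq_trans deg_gt2) ?leq_addr //.
apply: leq_trans (leq_sum _ (fun p _ => outdeg_sole_ge2 p.1 p.2)).
by rewrite sum_nat_const cardC1 card_prod card_bool card_ord.
Qed.

Lemma sole_edge_cross b i j k l :
  sole_edge (E b) i j -> sole_edge (E (~~ b)) k l -> k != i -> k != j -> l == i.
Proof.
move=> sij skl ki kj; rewrite eq_sym -(sole_edgeE _ skl) E_dual 1?eq_sym //.
by rewrite (sole_edgeE _ sij).
Qed.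

Lemma sole_2cycle_no_edge b i j k l : uniq [:: i; j; k; l] ->
  sole_2cycle (E b) i j -> ~~ E (~~ b) k l.
Proof.
move=> Uq /andP[sij sji]; apply/negP => Ekl.
have Eki : E (~~ b) k i by rewrite E_dual ?(sole_edgeE _ sij); distinct4.
have Ekj : E (~~ b) k j by rewrite E_dual ?(sole_edgeE _ sji); distinct4.
have : (#|[:: i; j; l]| <= #|E (~~ b) k|)%N.
  by apply/subset_leq_card/subsetP => x; rewrite !inE => /or3P[] /eqP->.
have /card_uniqP-> : uniq [:: i; j; l] by distinct4.
by rewrite leqNgt ltnS outdeg_le2.
Qed.

Lemma no_sole_3cycle b i j k : uniq [:: i; j; k] ->
  sole_edge (E b) i j -> sole_edge (E b) j k -> ~~ sole_edge (E b) k i.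
Proof.
move=> Uijk sij sjk; apply/negP => ski; have [l Uq] := uniq3_extend Uijk.
have [b' [x sxl]] := sole_edge_into l.
have [Eb | Eb] : b' = b \/ b' = ~~ b.
  by case: b b' {sij sjk ski sxl} => [] []; auto.
  rewrite Eb in sxl; have := uniq4_mem x Uq; have := sole_edge_neq sxl.
  have := sole_edge_source_neq sij sxl; have := sole_edge_source_neq sjk sxl.
  have := sole_edge_source_neq ski sxl; distinct4.
have x_in y z : sole_edge (E b) y z -> l != y -> (x == y) || (x == z).
  move=> syz; apply: contraNT; rewrite negb_or => /andP[xy xz].
  by rewrite Eb in sxl; apply: sole_edge_cross syz sxl _ _.
have := x_in _ _ sij; have := x_in _ _ sjk; have := x_in _ _ ski; distinct4.
Qed.

Lemma sole_cycle b i j :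
    (forall k l, sole_edge (E b) k l -> exists h, sole_edge (E b) h k) ->
    sole_edge (E b) i j ->
  (exists k l, sole_2cycle (E b) k l) \/
  (exists k l p q, sole_4cycle (E b) k l p q).
Proof.
move=> sole_into sij; have [h shi] := sole_into _ _ sij.
case: (eqVneq h j) => [hj | hj].
  by left; exists i, j; rewrite /sole_2cycle sij -hj.
have [g sgh] := sole_into _ _ shi.
have Uhij : uniq [:: h; i; j].
  by have := sole_edge_neq sij; have := sole_edge_neq shi; distinct4.
case: (eqVneq g j) => [gj | gj].
  by move: sgh; rewrite gj (negPf (no_sole_3cycle Uhij shi sij)).
have gi : g != i.
  apply: contraNneq hj => gi; apply/eqP.
  by move: sgh; rewrite gi => /(sole_edge_out sij).
have Uq : uniq [:: g; h; i; j] by have := sole_edge_neq sgh; distinct4.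
have [e seg] := sole_into _ _ sgh; right; exists g, h, i, j.
suff /eqP ej : e == j by rewrite ej in seg.
have := uniq4_mem e Uq; have := sole_edge_neq seg.
have := sole_edge_source_neq shi seg; have := sole_edge_source_neq sij seg.
by distinct4.
Qed.

End DualDigraphs.

Section Semigroup.

Variable n : 'I_4 -> nat.

Local Notation "''n_' i" := (n i)%:Z
  (at level 8, i at level 2, format "''n_' i").

Implicit Types (x : int) (c : 'I_4 -> nat) (i j k l : 'I_4).

(* Coefficients above [`|x|] could only occur at generators equal to zero. *)
Definition numsgp : {pred int} :=
  fun x => [exists c : {ffun 'I_4 -> 'I_(`|x|%N.+1)},
              x == (\sum_(j < 4) c j * n j)%N%:Z].

Lemma inSP x : reflect (inS n x) (x \in numsgp).
Proof.
apply: (iffP existsP) => [[c /eqP->]|[c ->]].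
  by exists (fun j => val (c j)).
exists [ffun j => inord (if n j == 0 then 0 else c j)%N]; apply/eqP.
congr Posz; apply: eq_bigr => j _; rewrite ffunE inordK.
  by case: eqP => [->|//]; rewrite !muln0.
rewrite ltnS /= (bigD1 j) //=; apply: leq_trans (leq_addr _ _).
by case: eqP => // /eqP; rewrite -lt0n => nj; rewrite leq_pmulr.
Qed.

Lemma numsgp_sum c : (\sum_(j < 4) c j * n j)%N%:Z \in numsgp.
Proof. by apply/inSP; exists c. Qed.

Fact numsgp_nmod_closed : GRing.nmod_closed numsgp.
Proof.
split; first by apply/inSP; exists (fun=> 0%N); rewrite big1.
move=> _ _ /inSP[c ->] /inSP[d ->]; apply/inSP; exists (fun j => c j + d j)%N.
by rewrite -PoszD -big_split; congr Posz; apply: eq_bigr => j _; rewrite mulnDl.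
Qed.

HB.instance Definition _ :=
  GRing.isAddClosed.Build int numsgp numsgp_nmod_closed.

Lemma numsgp_gen i : 'n_i \in numsgp.
Proof.
apply/inSP; exists (fun j => j == i : nat); congr Posz.
by rewrite (bigD1 i) //= eqxx mul1n big1 ?addn0 // => j /negPf->.
Qed.

Lemma numsgp_ge0 x : x \in numsgp -> 0 <= x.
Proof. by case/inSP => c ->. Qed.

Lemma numsgpMz (p : int) x : 0 <= p -> x \in numsgp -> p * x \in numsgp.
Proof. by case: p => // p _ xS; rewrite -natz mulr_natl rpredMn. Qed.

Lemma numsgp_comb i j k l x (p q r s : int) :
  0 <= p -> 0 <= q -> 0 <= r -> 0 <= s ->
  x = p * 'n_i + q * 'n_j + r * 'n_k + s * 'n_l -> x \in numsgp.
Proof. by move=> *; subst x; rewrite !rpredD ?numsgpMz ?numsgp_gen. Qed.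

Lemma numsgp4P i j k l x : uniq [:: i; j; k; l] -> x \in numsgp ->
  exists p q r s : nat,
    x = p%:Z * 'n_i + q%:Z * 'n_j + r%:Z * 'n_k + s%:Z * 'n_l.
Proof.
move=> Uq /inSP[c ->]; exists (c i), (c j), (c k), (c l).
by rewrite -!PoszM -!PoszD; congr Posz; apply: uniq4_sum.
Qed.

Lemma numsgp_sub_gen c j :
  (0 < c j)%N -> (\sum_(k < 4) c k * n k)%N%:Z - 'n_j \in numsgp.
Proof.
move=> cj; rewrite (bigD1 j) //= PoszD addrAC.
have -> : (c j * n j)%N%:Z - 'n_j = ((c j).-1 * n j)%N%:Z.
  by rewrite -{1}(prednK cj); lia.
rewrite -PoszD; apply/inSP; exists (fun k => if k == j then (c j).-1 else c k).
congr Posz; rewrite [RHS](bigD1 j) //= eqxx; congr addn.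
by apply: eq_bigr => k /negPf->.
Qed.

Lemma numsgp_neq0_sub_gen x : x \in numsgp -> x != 0 ->
  exists2 j, (0 < n j)%N & x - 'n_j \in numsgp.
Proof.
case/inSP=> c -> nz; have [j] : exists j, (0 < c j * n j)%N.
  apply/existsP; apply: contraNT nz => /existsPn cn0.
  by rewrite big1 // => j _; move: (cn0 j); rewrite lt0n negbK => /eqP.
by rewrite muln_gt0 => /andP[cj nj]; exists j => //; apply: numsgp_sub_gen.
Qed.

End Semigroup.

Lemma inS_withoutP n i x :
  reflect (inS_without n i x) (x \in numsgp [eta n with i |-> 0%N]).
Proof.
apply: (iffP (inSP _ _)) => [[c ->]|[c [ci0 ->]]].
  exists [eta c with i |-> 0%N]; split; first by rewrite /= eqxx.
  by congr Posz; apply: eq_bigr => j _ /=; case: eqP => // _; rewrite muln0.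
exists c; congr Posz; apply: eq_bigr => j _ /=; case: eqP => // ->.
by rewrite ci0.
Qed.

Lemma numsgp_without_sub n i :
  {subset numsgp [eta n with i |-> 0%N] <= numsgp n}.
Proof. by move=> x /inS_withoutP[c [_ ->]]; apply: numsgp_sum. Qed.

Section MinimalGenerators.

Variables n alpha : 'I_4 -> nat.
Hypothesis n_min : min_gen4_numsgp n.
Hypothesis alphaP : forall i, is_alpha n i (alpha i).

Local Notation S := (numsgp n).
Local Notation "''n_' i" := (n i)%:Z
  (at level 8, i at level 2, format "''n_' i").
Local Notation "''a_' i" := (alpha i)%:Z
  (at level 8, i at level 2, format "''a_' i").

Implicit Types (g x : int) (i j k l : 'I_4).

Lemma gen_notin_without i : 'n_i \notin numsgp [eta n with i |-> 0%N].
Proof. by apply/inS_withoutP; have [_] := n_min; apply. Qed.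

Lemma gen_gt0 i : (0 < n i)%N.
Proof.
by rewrite lt0n; apply: contraNneq (gen_notin_without i) => ->; apply: rpred0.
Qed.

Lemma gen_inj : injective n.
Proof.
move=> i j nij; apply: contraNeq (gen_notin_without i) => ij.
by have := numsgp_gen [eta n with i |-> 0%N] j; rewrite /= ifN_eqC // nij.
Qed.

Lemma numsgp_without_comb i j k l x (p q r : int) : i \notin [:: j; k; l] ->
  0 <= p -> 0 <= q -> 0 <= r -> x = p * 'n_j + q * 'n_k + r * 'n_l ->
  x \in numsgp [eta n with i |-> 0%N].
Proof.
rewrite !inE !negb_or => /and3P[ij ik il] p0 q0 r0 ->.
apply: (@numsgp_comb _ i j k l _ 0 p q r) => //=.
by rewrite eqxx mul0r add0r !ifN_eqC.
Qed.

Lemma alpha_le i j k l (b p q r : int) : i \notin [:: j; k; l] -> 0 < b ->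
  0 <= p -> 0 <= q -> 0 <= r -> b * 'n_i = p * 'n_j + q * 'n_k + r * 'n_l ->
  'a_i <= b.
Proof.
case: b => // b i_notin b0 p0 q0 r0 E.
rewrite lez_nat leqNgt; apply/negP => lt_b.
have [_ [_ /(_ b b0 lt_b)]] := alphaP i; apply; apply/inS_withoutP.
by rewrite PoszM; apply: numsgp_without_comb E.
Qed.

Lemma alpha_rel i j k l : uniq [:: i; j; k; l] ->
  exists p q r : nat, 'a_i * 'n_i = p%:Z * 'n_j + q%:Z * 'n_k + r%:Z * 'n_l.
Proof.
move=> Uq; have [_ [[c [ci0 E]] _]] := alphaP i; exists (c j), (c k), (c l).
by rewrite -PoszM E (uniq4_sum _ Uq) ci0 mul0n add0r -!PoszM -!PoszD.
Qed.

Lemma alpha_gt1 i : (1 < alpha i)%N.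
Proof.
have [a0 [aS _]] := alphaP i; rewrite ltn_neqAle a0 andbT.
apply: contraNneq (gen_notin_without i) => a1.
by apply/inS_withoutP; rewrite -(mul1n (n i)) a1.
Qed.

(* In a nonzero relation between three generators one coefficient has the
   opposite sign of the other two; [alpha_le] bounds it from below. *)
Lemma relation3_eq0 j k l (x y z : int) : uniq [:: j; k; l] ->
  x * 'n_j + y * 'n_k + z * 'n_l = 0 ->
  0 <= x < 'a_j -> - 'a_k < y -> - 'a_l < z -> [/\ x = 0, y = 0 & z = 0].
Proof.
move=> Uq E /andP[x0 xa] ya za.
have [nj nk nl] := And3 (gen_gt0 j) (gen_gt0 k) (gen_gt0 l).
case: (ltP y 0) => y0; case: (ltP z 0) => z0.
- suff: 'a_j <= x by lia.
  have yn : y * 'n_k < 0 by rewrite nmulr_rlt0.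
  have zn : z * 'n_l < 0 by rewrite nmulr_rlt0.
  have x_gt0 : 0 < x by rewrite -(@pmulr_lgt0 _ 'n_j) //; lia.
  by apply: (@alpha_le j k l l _ (- y) (- z) 0); try lia; distinct4.
- suff: 'a_k <= - y by lia.
  by apply: (@alpha_le k j l l _ x z 0); try lia; distinct4.
- suff: 'a_l <= - z by lia.
  by apply: (@alpha_le l j k k _ x y 0); try lia; distinct4.
- by split; nia.
Qed.

Lemma isPF_notin g : isPF n g -> g \notin S.
Proof. by case=> gS _; apply/inSP. Qed.

Lemma isPF_addr g x : isPF n g -> x \in S -> x != 0 -> g + x \in S.
Proof. by case=> _ gP /inSP xS /eqP x0; apply/inSP/gP. Qed.

Lemma isPF_add_gen g i : isPF n g -> g + 'n_i \in S.
Proof.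
by move=> gPF; rewrite isPF_addr ?numsgp_gen // eqz_nat -lt0n gen_gt0.
Qed.

Lemma isPF_gt0 g : isPF n g -> 0 < g.
Proof.
move=> gPF; rewrite ltNge; apply/negP => g_le0.
have g_neq0 : g != 0.
  by apply: contraNneq (isPF_notin gPF) => ->; apply: rpred0.
case: (@arg_minnP _ ord0 predT n isT) => i _ n_ge.
have gE : g = - 'n_i.
  apply/eqP; rewrite -subr_eq0 opprK; apply: contraT => nz.
  have [j _ /numsgp_ge0] := numsgp_neq0_sub_gen (isPF_add_gen i gPF) nz.
  by have := n_ge j isT; lia.
have [j] : exists j, j \notin [:: i].
  by apply: exists_notin_seq; rewrite card_ord.
rewrite inE => ji; have [k [l Uq]] := uniq2_extend ji.
have [p [q [r [s E]]]] := numsgp4P Uq (isPF_add_gen j gPF).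
have p0 : p = 0%N by have := gen_gt0 i; case: p E => // p; nia.
case/negP: (gen_notin_without j).
by apply: (@numsgp_without_comb j i k l _ (q%:Z + 1) r s); try lia; distinct4.
Qed.

Lemma isFrobenius_isPF F : isFrobenius n F -> isPF n F.
Proof.
move=> [FS F_max]; split=> // s /inSP sS s0; apply: F_max.
by have := numsgp_ge0 sS; lia.
Qed.

Definition edge g : rel 'I_4 := fun i j => g + 'n_i - 'n_j \in S.

Lemma edge_irr g i : isPF n g -> edge g i i = false.
Proof. by move/isPF_notin/negPf; rewrite /edge addrK. Qed.

Lemma edge_exists g i : isPF n g -> exists j, edge g i j.
Proof.
move=> gPF; have [|j _ gij] := numsgp_neq0_sub_gen (isPF_add_gen i gPF).
  by have := isPF_gt0 gPF; lia.
by exists j.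
Qed.

Lemma edge_comb g i j k l (p q r : int) : 0 <= p -> 0 <= q -> 0 <= r ->
  g + 'n_i = (p + 1) * 'n_j + q * 'n_k + r * 'n_l -> edge g i j.
Proof.
move=> p0 q0 r0 E; apply: (@numsgp_comb _ j k l l _ p q r 0) => //.
by rewrite E; lia.
Qed.

Lemma PF_factorization g i j k l : isPF n g -> uniq [:: i; j; k; l] ->
  exists p q r : nat, g + 'n_i = p%:Z * 'n_j + q%:Z * 'n_k + r%:Z * 'n_l.
Proof.
move=> gPF Uq; have [p [q [r [s E]]]] := numsgp4P Uq (isPF_add_gen i gPF).
exists q, r, s; case: p E => [|p] E; first by rewrite E; lia.
case/negP: (isPF_notin gPF).
by apply: (@numsgp_comb _ i j k l _ p q r s) => //; lia.
Qed.

Lemma nonedge_factorization g i j k l : isPF n g -> uniq [:: i; j; k; l] ->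
  ~~ edge g i l -> exists p q : nat, g + 'n_i = p%:Z * 'n_j + q%:Z * 'n_k.
Proof.
move=> gPF Uq; have [p [q [[|r] E]]] := PF_factorization gPF Uq.
  by exists p, q; rewrite E; lia.
by case/negP; apply: (@edge_comb _ _ _ j k r p q); lia.
Qed.

Lemma sole_edge_factorization g i j : isPF n g -> sole_edge (edge g) i j ->
  exists p : nat, g + 'n_i = p%:Z * 'n_j.
Proof.
move=> gPF sij; have /inSP[c E] := isPF_add_gen i gPF; exists (c j).
rewrite E (bigD1 j) //= big1 ?addn0 ?PoszM // => k kj.
case: (posnP (c k)) => [-> // | ck]; have := sole_edgeE k sij.
by rewrite /edge E numsgp_sub_gen // (negPf kj).
Qed.

Lemma sole_edge_eq g i j : isPF n g -> sole_edge (edge g) i j ->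
  g + 'n_i = ('a_j - 1) * 'n_j.
Proof.
move=> gPF sij; have [p E] := sole_edge_factorization gPF sij.
suff [le_alpha p_lt] : 'a_j <= p%:Z + 1 /\ p%:Z < 'a_j.
  by rewrite E; congr (_ * _); lia.
have ij : i != j by rewrite -(sole_edgeE i sij) edge_irr.
split.
  have [k [l Uq]] := uniq2_extend ij.
  have Uj : uniq [:: j; i; k; l] by distinct4.
  have [a [b [c Ej]]] := PF_factorization gPF Uj.
  by apply: (@alpha_le j i k l _ (a%:Z + 1) b c); try lia; distinct4.
rewrite ltNge; apply/negP => alpha_le_p.
have [a0 [/inS_withoutP aS _]] := alphaP j.
have [|k] := numsgp_neq0_sub_gen aS.
  by rewrite eqz_nat muln_eq0 negb_or -!lt0n a0 gen_gt0.
rewrite /=; case: eqP => // /eqP kj _ /numsgp_without_sub akS.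
suff : edge g i k by rewrite (sole_edgeE k sij) (negPf kj).
rewrite /edge; have -> : g + 'n_i - 'n_k
    = (p%:Z - 'a_j) * 'n_j + ((alpha j * n j)%N%:Z - 'n_k) by lia.
by rewrite rpredD ?numsgpMz ?numsgp_gen // subr_ge0.
Qed.

Lemma sole_edge_inj g i i' j :
  isPF n g -> sole_edge (edge g) i j -> sole_edge (edge g) i' j -> i = i'.
Proof.
move=> gPF /(sole_edge_eq gPF) E /(sole_edge_eq gPF) E'.
by apply: gen_inj; lia.
Qed.

(* By Bezout [gcd(n_i, n_j) * n_l = c * n_i + d * n_j] for some integers [c] and
   [d]; as [alpha_i * n_i = alpha_j * n_j] we may take [0 <= c < alpha_i], and
   then [d < 0] would put [g] into the semigroup. *)
Lemma alpha_le_gcd g i j k l : isPF n g -> uniq [:: i; j; k; l] ->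
  sole_2cycle (edge g) i j -> (alpha l <= gcdn (n i) (n j))%N.
Proof.
move=> gPF Uq /andP[/(sole_edge_eq gPF) Eij /(sole_edge_eq gPF) Eji].
have [u [v Bez]] : exists u v, u * 'n_i + v * 'n_j = (gcdn (n i) (n j))%:Z.
  by have [u [v E]] := Bezoutz 'n_i 'n_j; exists u, v.
have h_gt0 : (0 < gcdn (n i) (n j))%N by rewrite gcdn_gt0 gen_gt0.
have ai0 : 'a_i != 0 by rewrite eqz_nat -lt0n ltnW ?alpha_gt1.
set h := gcdn _ _ in Bez h_gt0 *.
pose t := ((u * 'n_l) %/ 'a_i)%Z; pose c := ((u * 'n_l) %% 'a_i)%Z.
have c_ge0 : 0 <= c by apply: modz_ge0.
have c_lt : c < 'a_i by apply: ltz_pmod; rewrite lt0r ai0.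
have Ec : u * 'n_l = t * 'a_i + c by apply: divz_eq.
have Ea : 'a_i * 'n_i = 'a_j * 'n_j by lia.
pose d := v * 'n_l + t * 'a_j.
have Eh : h%:Z * 'n_l = c * 'n_i + d * 'n_j.
  have -> : h%:Z * 'n_l = (u * 'n_l) * 'n_i + (v * 'n_l) * 'n_j.
    by rewrite -Bez; lia.
  have : t * ('a_i * 'n_i) = t * ('a_j * 'n_j) by rewrite Ea.
  by rewrite Ec /d; lia.
case: (leP 0 d) => d0.
  by rewrite -lez_nat; apply: (@alpha_le l i j j _ c d 0); try lia; distinct4.
case/negP: (isPF_notin gPF).
by apply: (@numsgp_comb _ l i j j _ h ('a_i - 1 - c) (- d - 1) 0); lia.
Qed.

End MinimalGenerators.

Definition parity_pair (n : 'I_4 -> nat) (f : bool -> int) : Prop :=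
  [/\ forall b, isPF n (f b), forall b, odd `|f b|%N = b,
      f true + f false \notin numsgp n
    & forall x, x \notin numsgp n -> f true + f false - x \notin numsgp n ->
        exists b, x = f b].

Lemma card_ord_mem (m : nat) (s : seq nat) : uniq s ->
  {in s, forall x, x < m}%N -> #|[set x : 'I_m | val x \in s]| = size s.
Proof.
move=> s_uniq s_lt; rewrite cardE -(size_map val).
apply/perm_size/uniq_perm => //.
  by rewrite map_inj_uniq ?enum_uniq //; apply: val_inj.
move=> x; apply/mapP/idP => [[y] | xs]; first by rewrite mem_enum inE => ys ->.
by exists (Ordinal (s_lt x xs)); rewrite // mem_enum inE.
Qed.

Section AlmostSymmetric.

Variable n : 'I_4 -> nat.
Hypothesis n_min : min_gen4_numsgp n.

Local Notation S := (numsgp n).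

Implicit Types x F : int.

Lemma isPF_sub_Frobenius_notin F x :
  isFrobenius n F -> isPF n x -> x != F -> F - x \notin S.
Proof.
move=> FFrob xPF xF; have := isPF_notin (isFrobenius_isPF FFrob).
apply: contra => /(isPF_addr xPF).
by rewrite subr_eq0 eq_sym xF [x + _]addrC subrK; apply.
Qed.

Lemma le_Frobenius F x : isFrobenius n F -> x \notin S -> x <= F.
Proof.
by move=> [_ F_max] xS; rewrite leNgt; apply: contra xS => /F_max/inSP.
Qed.

Lemma card_gaps_ord (m g : nat) : isFrobenius n m -> has_genus n g ->
  #|[set x : 'I_m.+1 | x%:Z \notin S]| = g.
Proof.
move=> mFrob [gs [gs_uniq [<- gsP]]].
have gs_gap (x : nat) : (x \in gs) = (x%:Z \notin S).
  by apply/idP/idP => [/gsP xS | /inSP xS]; [apply/inSP | apply/gsP].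
rewrite -(card_ord_mem (m := m.+1) gs_uniq) => [|x].
  by apply: eq_card => x; rewrite !inE gs_gap.
by rewrite gs_gap => /(le_Frobenius mFrob).
Qed.

Lemma card_PF_ord (m : nat) (ps : seq int) : isFrobenius n m -> uniq ps ->
    (forall x, x \in ps <-> isPF n x) ->
  #|[set x : 'I_m.+1 | x%:Z \in ps]| = size ps.
Proof.
move=> mFrob ps_uniq psP.
have ps_gt0 x : x \in ps -> 0 < x by move/psP/(isPF_gt0 n_min).
have ps_le x : x \in ps -> x <= m by move/psP/isPF_notin/(le_Frobenius mFrob).
rewrite -(size_map absz) -(@card_ord_mem m.+1).
- apply: eq_card => x; rewrite !inE; apply/idP/mapP => [xps | [y yps /= ->]].
    by exists x%:Z.
  by rewrite gtz0_abs ?ps_gt0.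
- by rewrite map_inj_in_uniq // => x y /ps_gt0 x0 /ps_gt0 y0; lia.
- by move=> _ /mapP[x xps ->]; have := ps_le _ xps; have := ps_gt0 _ xps; lia.
Qed.

(* The [F - s] with [s <= F] in [S] are [F + 1 - g] of the [g] gaps and share only
   [F] with the [t] pseudo-Frobenius numbers; but [(F + 1 - g) + t - 1 = g]. *)
Lemma almost_symmetric_gap : almost_symmetric n -> exists2 F, isFrobenius n F &
  forall x, x \notin S -> F - x \notin S -> isPF n x.
Proof.
move=> [F [g [t [FFrob [genus_g [[ps [ps_uniq [ps_size psP]]] EF]]]]]].
exists F => //; have F_gt0 := isPF_gt0 n_min (isFrobenius_isPF FFrob).
case: F FFrob EF F_gt0 => // m FFrob EF _; have FPF := isFrobenius_isPF FFrob.
pose gaps := [set x : 'I_m.+1 | x%:Z \notin S].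
pose mirror := [set rev_ord x | x in ~: gaps].
pose PF := [set x : 'I_m.+1 | x%:Z \in ps].
have card_gaps : #|gaps| = g by apply: card_gaps_ord.
have card_PF : #|PF| = t by rewrite -ps_size; apply: card_PF_ord.
have card_mirror : (g + #|mirror| = m.+1)%N.
  rewrite card_imset; last exact: rev_ord_inj.
  by rewrite -card_gaps cardsC card_ord.
have mirrorP (x : 'I_m.+1) : x \in mirror -> m%:Z - x%:Z \in S.
  case/imsetP => y; rewrite !inE negbK => yS ->.
  by have -> : m%:Z - (rev_ord y)%:Z = y by have := ltn_ord y; rewrite /=; lia.
have mirrorI : mirror :&: PF \subset [set ord_max].
  apply/subsetP => x; rewrite !inE => /andP[/mirrorP FxS /psP xPF].
  by apply: contraLR FxS => x_max; apply: isPF_sub_Frobenius_notin.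
have gapsE : mirror :|: PF = gaps.
  apply/eqP; rewrite eqEcard; apply/andP; split.
    apply/subsetP => x; rewrite in_setU !inE.
    case/orP => [/mirrorP FxS | /psP/isPF_notin //].
    by apply: contra (isPF_notin FPF) => /(rpredD FxS); rewrite subrK.
  by rewrite cardsU; have := subset_leq_card mirrorI; rewrite cards1; lia.
move=> x xS FxS; have := le_Frobenius FFrob xS; have := le_Frobenius FFrob FxS.
case: x xS FxS => [x|x] xS FxS FxF x_le; last by exfalso; lia.
have : Ordinal (x_le : (x < m.+1)%N) \in mirror :|: PF by rewrite gapsE inE.
rewrite in_setU => /orP[/mirrorP | ]; first by rewrite (negPf FxS).
by rewrite inE => /psP.
Qed.

Lemma has_type3 F : isPF n F -> has_type n 3 ->
  exists p q, uniq [:: F; p; q] /\ forall x, isPF n x <-> x \in [:: F; p; q].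
Proof.
move=> FPF [ps [ps_uniq [ps_size psP]]].
have /perm_to_rem ps_perm : F \in ps by apply/psP.
move: (perm_uniq ps_perm) (perm_size ps_perm) (perm_mem ps_perm).
rewrite ps_uniq ps_size; case: (rem F ps) => [|p [|q []]] // Fpq_uniq _ psE.
exists p, q; split=> // x.
by rewrite -psE; apply: iff_sym.
Qed.

Lemma type3_PF_sum F p q : isFrobenius n F ->
    (forall x, x \notin S -> F - x \notin S -> isPF n x) ->
    uniq [:: F; p; q] -> (forall x, isPF n x <-> x \in [:: F; p; q]) ->
  p + q = F /\ odd `|F|%N.
Proof.
move=> FFrob gapP /= /and3P[]; rewrite !inE negb_or => /andP[pF qF] pq _ PFE.
have FPF := isFrobenius_isPF FFrob; have F_gt0 := isPF_gt0 n_min FPF.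
have dualPF x : isPF n x -> x != F -> F - x \in [:: F; p; q].
  move=> xPF xF; apply/PFE; apply: gapP; first exact: isPF_sub_Frobenius_notin.
  by rewrite subKr isPF_notin.
have [pPF qPF] : isPF n p /\ isPF n q.
  by split; apply/PFE; rewrite !inE eqxx ?orbT.
have [p_gt0 q_gt0] := (isPF_gt0 n_min pPF, isPF_gt0 n_min qPF).
have Epq : p + q = F.
  by have := dualPF p pPF; have := dualPF q qPF; rewrite !inE; lia.
split=> //; apply: contraT => F_even.
have [h Eh] : exists h : int, F = h + h by exists (F %/ 2)%Z; lia.
have hS : h \notin S.
  by apply: contra (isPF_notin FPF) => hS; rewrite Eh rpredD.
have /PFE : isPF n h by apply: gapP; rewrite // Eh addrK.
by rewrite !inE; lia.
Qed.

Lemma almost_symmetric_type3 : almost_symmetric n -> has_type n 3 ->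
  exists2 f, parity_pair n f &
    forall x, isPF n x <-> x \in [:: f true; f false; f true + f false].
Proof.
move=> /almost_symmetric_gap[F FFrob gapP] type3.
have FPF := isFrobenius_isPF FFrob.
have [p [q [Fpq_uniq PFE]]] := has_type3 FPF type3.
have [Epq F_odd] := type3_PF_sum FFrob gapP Fpq_uniq PFE.
have [pPF qPF] : isPF n p /\ isPF n q.
  by split; apply/PFE; rewrite !inE eqxx ?orbT.
pose f b := if odd `|p|%N == b then p else q.
have Ef : f true + f false = F by rewrite /f; case: odd => //=; rewrite addrC.
have fE x : (x \in [:: f true; f false]) = (x \in [:: p; q]).
  by rewrite /f !inE; case: odd => //=; rewrite orbC.
exists f => [|x]; last by rewrite PFE inE -fE Ef !inE orbC -orbA.
split=> [b | b | | x xS FxS]; rewrite ?Ef.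
- by rewrite /f; case: eqP.
- by rewrite /f; case: eqP => //; lia.
- exact: isPF_notin.
have : x \in [:: F; p; q] by apply/PFE/gapP; rewrite // -Ef.
rewrite inE -fE => /predU1P[xF | ].
  by move: FxS; rewrite Ef xF subrr rpred0.
by rewrite !inE => /orP[] /eqP->; [exists true | exists false].
Qed.

End AlmostSymmetric.

Definition pair_edge (n : 'I_4 -> nat) (f : bool -> int) b : rel 'I_4 :=
  edge n (f b).

Section ParityPair.

Variables (n alpha : 'I_4 -> nat) (f : bool -> int).
Hypothesis n_min : min_gen4_numsgp n.
Hypothesis alphaP : forall i, is_alpha n i (alpha i).
Hypothesis n_odd : forall i, odd (n i).
Hypothesis f_pair : parity_pair n f.

Local Notation S := (numsgp n).
Local Notation F := (f true + f false).
Local Notation E := (pair_edge n f).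
Local Notation "''n_' i" := (n i)%:Z
  (at level 8, i at level 2, format "''n_' i").
Local Notation "''a_' i" := (alpha i)%:Z
  (at level 8, i at level 2, format "''a_' i").

Implicit Types (b : bool) (i j k l : 'I_4).

Let fPF b : isPF n (f b).
Proof. by case: f_pair. Qed.

Let f_odd b : odd `|f b|%N = b.
Proof. by case: f_pair. Qed.

Let F_notin : F \notin S.
Proof. by case: f_pair. Qed.

Lemma pair_sum b : f b + f (~~ b) = F.
Proof. by case: b; rewrite // addrC. Qed.

Lemma edge_dual b i j : i != j -> E (~~ b) j i = ~~ E b i j.
Proof.
move=> ij; have sumF := pair_sum b; apply/idP/idP => [Eji | nEij].
  apply: contra F_notin => Eij.
  by have := rpredD Eij Eji; congr (_ \in S); lia.
have dual_x : F - (f b + 'n_i - 'n_j) = f (~~ b) + 'n_j - 'n_i by lia.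
apply: contraT => nEji; rewrite /pair_edge /edge -dual_x in nEji.
have [_ _ _ gap_dual] := f_pair; have [b' Eb'] := gap_dual _ nEij nEji.
have bb' : b' = b.
  have := congr1 (fun z : int => odd `|z|%N) Eb'; rewrite f_odd => <-.
  by have := f_odd b; have := n_odd i; have := n_odd j; clear; lia.
by case/eqP: ij; apply: (gen_inj n_min); rewrite bb' in Eb'; lia.
Qed.

Lemma sole_edge_odd b i j : sole_edge (E b) i j -> odd (alpha j) = b.
Proof.
move/(sole_edge_eq n_min alphaP (fPF b)).
by have := f_odd b; have := n_odd i; have := n_odd j; lia.
Qed.

Lemma sole_pair_inj b b' i i' j :
  sole_edge (E b) i j -> sole_edge (E b') i' j -> b = b' /\ i = i'.
Proof.
move=> sij si'j; have bb' : b = b'.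
  by rewrite -(sole_edge_odd sij) (sole_edge_odd si'j).
rewrite -bb' in si'j; split=> //.
by apply: (sole_edge_inj n_min alphaP (fPF b) sij).
Qed.

Lemma pair_edge_dual_digraphs : dual_digraphs E.
Proof.
split=> [b i|||]; [exact: edge_irr | exact: edge_dual | | exact: sole_pair_inj].
by move=> b i; apply: edge_exists.
Qed.

Lemma numsgp_half w i : 2 * w = F + 'n_i -> w \in S.
Proof.
move=> Ew; apply: contraT => wS.
have [_ _ _ /(_ w wS) gap_dual] := f_pair; have [|b Eb] := gap_dual.
  apply: contra wS => FwS; have := rpredD FwS (numsgp_gen n i).
  by congr (_ \in S); lia.
have := isPF_add_gen n_min i (fPF (~~ b)); have -> : f (~~ b) + 'n_i = f b.
  by have := pair_sum b; lia.
by rewrite (negPf (isPF_notin (fPF b))).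
Qed.

Lemma F_factorization_coef_eq0 i j k l (c p q r : int) :
  0 <= c -> 0 <= p -> 0 <= q -> 0 <= r ->
  F + 'n_i = c * 'n_i + p * 'n_j + q * 'n_k + r * 'n_l -> c = 0.
Proof.
move=> c0 p0 q0 r0 EF; apply: contraNeq F_notin => cn0.
by apply: (@numsgp_comb _ i j k l _ (c - 1) p q r); lia.
Qed.

Lemma alternating_path_rel i j k l : uniq [:: i; j; k; l] ->
    sole_edge (E true) i j -> sole_edge (E false) j k ->
  exists d u v : nat, 'a_l * 'n_l = d%:Z * 'n_i + u%:Z * 'n_j + v%:Z * 'n_k /\
    (0 < d \/ odd (alpha l))%N.
Proof.
move=> Uq sij sjk; have Ul : uniq [:: l; i; j; k] by distinct4.
have [[] [x sxl]] := sole_edge_into pair_edge_dual_digraphs l.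
  have [d [u [v El]]] := alpha_rel alphaP Ul; exists d, u, v; split=> //.
  by right; rewrite (sole_edge_odd sxl).
have xi : x = i.
  apply/eqP; apply: contraT => xi.
  have xj : x != j by have := sole_edge_source_neq sjk sxl; distinct4.
  by have := sole_edge_cross pair_edge_dual_digraphs sij sxl xi xj; distinct4.
have [d [u [v El]]] := PF_factorization n_min (fPF false) Ul.
have := sole_edge_eq n_min alphaP (fPF false) sxl; rewrite xi => Ei.
by exists d.+1, u, v; split; [lia | left].
Qed.

(* As [F + n_i] is even, its half lies in the semigroup; in the resulting even
   factorization the coefficient of [n_l] is then reduced modulo [alpha_l]. *)
Lemma F_factorization_reduced i j k l (d u v : nat) : uniq [:: i; j; k; l] ->
    'a_l * 'n_l = d%:Z * 'n_i + u%:Z * 'n_j + v%:Z * 'n_k ->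
  exists p r q t s : nat,
    [/\ (q.*2 = t * alpha l + s)%N, (s < alpha l)%N, (t * d = 0)%N &
      F + 'n_i = (2 * p%:Z + t%:Z * u%:Z) * 'n_j
                   + (2 * r%:Z + t%:Z * v%:Z) * 'n_k + s%:Z * 'n_l].
Proof.
move=> Uq El; have [w Ew] : exists w : int, 2 * w = F + 'n_i.
  exists ((F + 'n_i) %/ 2)%Z; clear El.
  by have := n_odd i; have := f_odd true; have := f_odd false; lia.
have [c [p [r [q Epr]]]] := numsgp4P Uq (numsgp_half Ew).
pose t := (q.*2 %/ alpha l)%N; pose s := (q.*2 %% alpha l)%N.
have Eq : q.*2 = (t * alpha l + s)%N by apply: divn_eq.
have EF : F + 'n_i = (2 * c%:Z + t%:Z * d%:Z) * 'n_i
    + (2 * p%:Z + t%:Z * u%:Z) * 'n_j + (2 * r%:Z + t%:Z * v%:Z) * 'n_k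
    + s%:Z * 'n_l.
  have := congr1 ( *%R t%:Z) El.
  have : 2 * q%:Z * 'n_l = (t%:Z * 'a_l + s%:Z) * 'n_l by congr (_ * _); lia.
  by rewrite -Ew Epr; lia.
have c0 : 2 * c%:Z + t%:Z * d%:Z = 0.
  by apply: F_factorization_coef_eq0 EF; lia.
exists p, r, q, t, s; split=> //; [ | by lia | by rewrite EF c0; lia].
by rewrite ltn_pmod // ltnW ?(alpha_gt1 n_min alphaP).
Qed.

(* The two edges give [F + n_i = (alpha_j - 2) n_j + (alpha_k - 1) n_k], where
   [alpha_j] is odd.  This must be the reduced form of the even factorization,
   in which the coefficient of [n_j] is even because [t] is. *)
Lemma no_alternating_path i j k :
  sole_edge (E true) i j -> ~~ sole_edge (E false) j k.
Proof.
move=> sij; apply/negP => sjk.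
have ij := sole_edge_neq pair_edge_dual_digraphs sij.
have jk := sole_edge_neq pair_edge_dual_digraphs sjk.
have ki : k != i.
  apply: contraTneq sjk => ->; apply/negP => sji; have := edge_dual true ij.
  by rewrite (sole_edgeE _ sij) (sole_edgeE _ sji) !eqxx.
have [|l Uq] := @uniq3_extend i j k; first by distinct4.
have [d [u [v [El d_gt0_or_odd]]]] := alternating_path_rel Uq sij sjk.
have [p [r [q [t [s [Eq s_lt td0 EF]]]]]] := F_factorization_reduced Uq El.
have Eij := sole_edge_eq n_min alphaP (fPF _) sij.
have Ejk := sole_edge_eq n_min alphaP (fPF _) sjk.
have [s0 Ep _] : [/\ s%:Z = 0, 2 * p%:Z + t%:Z * u%:Z - ('a_j - 2) = 0
    & 2 * r%:Z + t%:Z * v%:Z - ('a_k - 1) = 0].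
  by apply: (@relation3_eq0 _ _ n_min alphaP l j k); by [distinct4 | lia].
have even_t : ~~ odd t.
  case: d_gt0_or_odd => [d_gt0 | odd_al].
    by case: t td0 {Eq EF Ep} => //; lia.
  by have := congr1 odd Eq; clear -odd_al s0; lia.
have : ~~ odd (t * u) by rewrite oddM (negPf even_t).
by have := sole_edge_odd sij; clear -Ep; lia.
Qed.

Lemma sole_2cycle_dvdz b i j k l : uniq [:: i; j; k; l] ->
  sole_2cycle (E b) i j -> ((gcdn (n i) (n j))%:Z %| f (~~ b) + 'n_k)%Z.
Proof.
move=> Uq /(sole_2cycle_no_edge pair_edge_dual_digraphs Uq) nkl.
have Uk : uniq [:: k; i; j; l] by distinct4.
have [p [q ->]] := nonedge_factorization n_min (fPF (~~ b)) Uk nkl.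
by rewrite rpredD ?dvdz_mull // dvdzE ?dvdn_gcdl ?dvdn_gcdr.
Qed.

Lemma sole_2cycle_odd b i j : sole_2cycle (E b) i j -> b = true.
Proof.
move=> /andP[sij sji]; apply: contraT => /negPf bF.
have ij := sole_edge_neq pair_edge_dual_digraphs sij.
have [k [l Uq]] := uniq2_extend ij; have ai := alpha_gt1 n_min alphaP i.
have half_alpha m : odd (alpha m) = b -> alpha m = ((alpha m)./2 * 2)%N.
  by rewrite bF muln2 => /negbT/even_halfK.
have Eij := sole_edge_eq n_min alphaP (fPF b) sij.
have Eji := sole_edge_eq n_min alphaP (fPF b) sji.
rewrite (half_alpha j (sole_edge_odd sij)) in Eij.
rewrite (half_alpha i (sole_edge_odd sji)) in Eji ai.
suff : 'a_i <= (alpha i)./2%:Z.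
  by rewrite (half_alpha i (sole_edge_odd sji)); lia.
by apply: (@alpha_le _ _ alphaP i j k l _ (alpha j)./2 0 0); try lia; distinct4.
Qed.

Lemma sole_2cycle_coprime b i j k l : uniq [:: i; j; k; l] ->
  sole_2cycle (E b) i j -> coprime (gcdn (n i) (n j)) (n l).
Proof.
move=> Uq cij; have Ulk : uniq [:: i; j; l; k] by distinct4.
rewrite /coprime -dvdn1 -[X in (_ %| X)%N](proj1 n_min).
apply/dvdn_biggcdP => m _; set d := gcdn _ (n l).
have dvd_d x : ((gcdn (n i) (n j))%:Z %| x)%Z -> (d%:Z %| x)%Z.
  by apply: dvdz_trans; rewrite dvdzE dvdn_gcdl.
have d_l : (d%:Z %| 'n_l)%Z by rewrite dvdzE dvdn_gcdr.
have d_k : (d%:Z %| 'n_k)%Z.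
  have -> : 'n_k = (f (~~ b) + 'n_k) - (f (~~ b) + 'n_l) + 'n_l by lia.
  have d_fk := dvd_d _ (sole_2cycle_dvdz Uq cij).
  have d_fl := dvd_d _ (sole_2cycle_dvdz Ulk cij).
  by rewrite rpredD // rpredB.
have := uniq4_mem m Uq; rewrite !inE => /or4P[] /eqP-> //.
- by apply: dvd_d 'n_i _; rewrite dvdzE dvdn_gcdl.
- by apply: dvd_d 'n_j _; rewrite dvdzE dvdn_gcdr.
Qed.

(* Otherwise [alpha_l * n_l], hence [alpha_l], is divisible by [gcd(n_i, n_j)].
   By [alpha_le_gcd] they are equal, but the gcd is odd and [alpha_l] is even. *)
Lemma sole_2cycle_no_dual_exit i j k l : uniq [:: i; j; k; l] ->
  sole_2cycle (E true) i j -> ~~ sole_edge (E false) i l.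
Proof.
move=> Uq cij; apply/negP => sil.
have Ulk : uniq [:: i; j; l; k] by distinct4.
have alE : 'a_l * 'n_l = f false + 'n_l + 'n_i.
  by have := sole_edge_eq n_min alphaP (fPF false) sil; lia.
have dvd_al : (gcdn (n i) (n j) %| alpha l)%N.
  rewrite -(Gauss_dvdl _ (sole_2cycle_coprime Uq cij)).
  suff : ((gcdn (n i) (n j))%:Z %| 'a_l * 'n_l)%Z by rewrite -PoszM.
  by rewrite alE rpredD ?(sole_2cycle_dvdz Ulk cij) // dvdzE dvdn_gcdl.
have al_gt0 : (0 < alpha l)%N by rewrite ltnW ?(alpha_gt1 n_min alphaP).
have al_gcd : alpha l = gcdn (n i) (n j).
  apply/eqP; rewrite eqn_leq; apply/andP; split; last exact: dvdn_leq.
  exact: (alpha_le_gcd n_min alphaP (fPF true) Uq).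
have := sole_edge_odd sil; rewrite al_gcd => even_gcd; have := n_odd i.
by rewrite -(divnK (dvdn_gcdl (n i) (n j))) oddM even_gcd andbF.
Qed.

(* Otherwise [(alpha_l - 2) * n_l], hence [alpha_l - 2], is divisible by
   [gcd(n_i, n_j)], which is at least [alpha_l]; but [alpha_l] is odd. *)
Lemma sole_2cycle_no_opposite_edge i j k l : uniq [:: i; j; k; l] ->
  sole_2cycle (E true) i j -> ~~ sole_edge (E true) k l.
Proof.
move=> Uq cij; apply/negP => skl; have [sij _] := andP cij.
have Ulk : uniq [:: i; j; l; k] by distinct4.
have al := alpha_gt1 n_min alphaP l.
have alE : (alpha l - 2)%N%:Z * 'n_l
    = ('a_j - 1) * 'n_j - 'n_i + (f false + 'n_k) - (f false + 'n_l).
  have := sole_edge_eq n_min alphaP (fPF true) skl.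
  have := sole_edge_eq n_min alphaP (fPF true) sij.
  by rewrite -subzn //; lia.
have dvd_al : (gcdn (n i) (n j) %| alpha l - 2)%N.
  rewrite -(Gauss_dvdl _ (sole_2cycle_coprime Uq cij)).
  suff : ((gcdn (n i) (n j))%:Z %| (alpha l - 2)%N%:Z * 'n_l)%Z.
    by rewrite -PoszM.
  have dvd_fk := sole_2cycle_dvdz Uq cij.
  have dvd_fl := sole_2cycle_dvdz Ulk cij.
  have dvd_i : ((gcdn (n i) (n j))%:Z %| 'n_i)%Z by rewrite dvdzE dvdn_gcdl.
  have dvd_j : ((gcdn (n i) (n j))%:Z %| 'n_j)%Z by rewrite dvdzE dvdn_gcdr.
  by rewrite alE rpredB // rpredD // rpredB // dvdz_mull.
have al2_gt0 : (0 < alpha l - 2)%N.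
  by have := sole_edge_odd skl; case: (alpha l) al => [|[|[|]]].
have := alpha_le_gcd n_min alphaP (fPF true) Uq cij.
by move/leq_trans => /(_ _ (dvdn_leq al2_gt0 dvd_al)); clear -al; lia.
Qed.

Lemma no_sole_2cycle b i j : ~~ sole_2cycle (E b) i j.
Proof.
apply/negP => cij; have Eb := sole_2cycle_odd cij; subst b.
have [sij sji] := andP cij; have cji := cij; rewrite sole_2cycleC in cji.
have [k [l Uq]] := uniq2_extend (sole_edge_neq pair_edge_dual_digraphs sij).
have Uji : uniq [:: j; i; k; l] by distinct4.
have [b [x sxl]] := sole_edge_into pair_edge_dual_digraphs l.
have xl := sole_edge_neq pair_edge_dual_digraphs sxl.
case: b sxl => sxl.
  have /eqP xk : x == k.
    have := uniq4_mem x Uq; have := sole_edge_source_neq sij sxl.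
    by have := sole_edge_source_neq sji sxl; distinct4.
  by move: sxl; rewrite xk (negPf (sole_2cycle_no_opposite_edge Uq cij)).
have := uniq4_mem x Uq; rewrite !inE (negPf xl) orbF.
case/or3P => /eqP xE; rewrite xE in sxl.
- by rewrite (negPf (sole_2cycle_no_dual_exit Uq cij)) in sxl.
- by rewrite (negPf (sole_2cycle_no_dual_exit Uji cji)) in sxl.
- have := sole_2cycle_no_edge pair_edge_dual_digraphs Uq cij.
  by rewrite (sole_edgeE l sxl) eqxx.
Qed.

Lemma pair_sub_notin b : f (~~ b) - f b \notin S.
Proof.
apply: contra (isPF_notin (fPF (~~ b))) => diffS.
suff /(isPF_addr (fPF b) diffS) : f (~~ b) - f b != 0 by rewrite addrC subrK.
have := f_odd b; have := f_odd (~~ b); clear; case: b => /=; lia.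
Qed.

(* Subtract a factorization of [f (~~ b) + n_i] without [n_i] and [n_l] from
   [2 f b + n_i = (alpha_j - 2) n_j + (alpha_k - 1) n_k]. *)
Lemma sole_4cycle_factorization b i j k l : sole_4cycle (E b) i j k l ->
  exists p q : nat, [/\ (p < alpha j)%N, (q < alpha k)%N
    & 2 * f b - f (~~ b) = p%:Z * 'n_j + q%:Z * 'n_k].
Proof.
move=> [Uq [sij sjk skl sli]].
have Ei := sole_edge_eq n_min alphaP (fPF b) sij.
have Ej := sole_edge_eq n_min alphaP (fPF b) sjk.
have Ek := sole_edge_eq n_min alphaP (fPF b) skl.
have nil : ~~ E (~~ b) i l.
  by rewrite edge_dual ?(sole_edgeE _ sli) ?eqxx //; distinct4.
have [p [q E']] := nonedge_factorization n_min (fPF (~~ b)) Uq nil.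
have p_lt : (p < alpha j - 1)%N.
  rewrite ltnNge; apply: contra (pair_sub_notin b) => p_ge.
  by apply: (@numsgp_comb _ j k k k _ (p%:Z - ('a_j - 1)) q 0 0); lia.
have q_lt : (q < alpha k)%N.
  have al := alpha_gt1 n_min alphaP l.
  rewrite ltnNge; apply: contra nil => q_ge.
  by apply: (@edge_comb _ _ _ l j k ('a_l - 2) (p%:Z + 1) (q%:Z - 'a_k)); lia.
exists (alpha j - 2 - p)%N, (alpha k - 1 - q)%N; split; [lia | lia |].
by rewrite -!subzn; lia.
Qed.

(* The three factorizations of [2 f b - f (~~ b)] obtained by rotating the cycle
   are all equal, because of their small coefficients, and no generator occurs in
   each of them. *)
Lemma sole_4cycle_double b i j k l :
  sole_4cycle (E b) i j k l -> f (~~ b) = 2 * f b.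
Proof.
move=> cyc; have cycj := sole_4cycle_rot cyc.
have cycl := sole_4cycle_rot (sole_4cycle_rot cycj); have [Uq _] := cyc.
have [p [q [p_lt q_lt Ejk]]] := sole_4cycle_factorization cyc.
have [p' [q' [p'_lt q'_lt Ekl]]] := sole_4cycle_factorization cycj.
have [p'' [q'' [p''_lt q''_lt Eij]]] := sole_4cycle_factorization cycl.
have [p0 _ _] : [/\ p%:Z = 0, q%:Z - p'%:Z = 0 & - q'%:Z = 0].
  by apply: (@relation3_eq0 _ _ n_min alphaP j k l); by [distinct4 | lia].
have [q0 _ _] : [/\ q%:Z = 0, p%:Z - q''%:Z = 0 & - p''%:Z = 0].
  by apply: (@relation3_eq0 _ _ n_min alphaP k j i); by [distinct4 | lia].
by move: Ejk; rewrite p0 q0; lia.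
Qed.

Lemma sole_4cycle_of_closed b i j :
    (forall k l, sole_edge (E b) k l -> exists h, sole_edge (E b) h k) ->
    sole_edge (E b) i j ->
  exists k l p q, sole_4cycle (E b) k l p q.
Proof.
move=> closed_b sij.
have [[k [l]]|//] := sole_cycle pair_edge_dual_digraphs closed_b sij.
by rewrite (negPf (no_sole_2cycle b k l)).
Qed.

Lemma no_even_sole_edge i j : ~~ sole_edge (E false) i j.
Proof.
apply/negP => /sole_4cycle_of_closed[k l skl|k [l [p [q]]]].
  have [[] [h shk]] := sole_edge_into pair_edge_dual_digraphs k.
    by rewrite (negPf (no_alternating_path l shk)) in skl.
  by exists h.
move/sole_4cycle_double/(congr1 (fun z : int => odd `|z|%N)).
by rewrite f_odd; lia.
Qed.

Lemma exists_sole_4cycle : exists i j k l, sole_4cycle (E true) i j k l.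
Proof.
have odd_into j : exists i, sole_edge (E true) i j.
  have [[] [i sij]] := sole_edge_into pair_edge_dual_digraphs j.
    by exists i.
  by rewrite (negPf (no_even_sole_edge i j)) in sij.
by have [i] := odd_into ord0; apply: sole_4cycle_of_closed.
Qed.

End ParityPair.

Lemma sole_4cycle_perm (e : rel 'I_4) i j k l : sole_4cycle e i j k l ->
  exists s : 'S_4, forall t, sole_edge e (s t) (s (ordS t)).
Proof.
move=> [Uq [sij sjk skl sli]].
have /tuple_uniqP tnth_inj : uniq [tuple i; j; k; l] by [].
exists (perm tnth_inj) => t; rewrite !permE !(tnth_nth i).
by case: t => [[|[|[|[|]]]]].
Qed.

Section CyclicRFmatrices.

Variables (n a : 'I_4 -> nat) (g : int).
Hypothesis a_gt1 : forall i, (1 < a i)%N.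
Hypothesis cyclic : forall i,
  g + (n i)%:Z = ((a (ordS i))%:Z - 1) * (n (ordS i))%:Z.

Let ord4 : seq 'I_4 := [:: inord 0; inord 1; inord 2; inord 3].

Let ord4_uniq : uniq ord4.
Proof. by rewrite /= !inE -!val_eqE /= !inordK. Qed.

Let cyclic_inord k m : m = (k.+1 %% 4)%N -> (k < 4)%N ->
  g + (n (inord k))%:Z = ((a (inord m))%:Z - 1) * (n (inord m))%:Z.
Proof.
move=> -> k4; rewrite cyclic.
have -> // : ordS (inord k : 'I_4) = inord (k.+1 %% 4).
by apply: val_inj; rewrite /= !inordK // ltn_mod.
Qed.

Lemma isRFmatrix_cyclic :
  isRFmatrix n g (RF1 a) /\ isRFmatrix n (2 * g) (RF2 a).
Proof.
have E0 := @cyclic_inord 0 1 erefl isT; have E1 := @cyclic_inord 1 2 erefl isT.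
have E2 := @cyclic_inord 2 3 erefl isT; have E3 := @cyclic_inord 3 0 erefl isT.
have [a0 a1] := (a_gt1 (inord 0), a_gt1 (inord 1)).
have [a2 a3] := (a_gt1 (inord 2), a_gt1 (inord 3)).
split=> i; rewrite (uniq4_sum _ ord4_uniq);
  have := uniq4_mem i ord4_uniq; rewrite !inE => /or4P[] /eqP->;
  rewrite !mxE !inordK //=; do 2![split=> //]; try lia;
  move=> j; have := uniq4_mem j ord4_uniq; rewrite !inE => /or4P[] /eqP->;
  by rewrite ?eqxx // mxE !inordK //=; lia.
Qed.

End CyclicRFmatrices.

Theorem theorem5p2 (n : 'I_4 -> nat) (alpha : 'I_4 -> nat) :
  min_gen4_numsgp n ->
  (forall i : 'I_4, is_alpha n i (alpha i)) ->
  almost_symmetric n ->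
  has_type n 3 ->
  (forall i : 'I_4, odd (n i)) ->
  exists f : int,
    0 < f /\
    (forall x : int, isPF n x <-> (x = f \/ x = 2 * f \/ x = 3 * f)) /\
    exists s : 'S_4,
      isRFmatrix (fun i => n (s i)) f (RF1 (fun i => alpha (s i))) /\
      isRFmatrix (fun i => n (s i)) (2 * f) (RF2 (fun i => alpha (s i))).
Proof.
move=> n_min alphaP AS type3 n_odd.
have [f f_pair PFE] := almost_symmetric_type3 n_min AS type3.
have fPF b : isPF n (f b) by case: f_pair.
have [i [j [k [l cyc]]]] := exists_sole_4cycle n_min alphaP n_odd f_pair.
have f_double := sole_4cycle_double n_min alphaP n_odd f_pair cyc.
exists (f true); split; first exact: (isPF_gt0 n_min (fPF true)).
split=> [x | ].
  rewrite PFE !inE f_double.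
  by split=> [/or3P[] /eqP | [|[]]] ->; lia.
have [s sole_s] := sole_4cycle_perm cyc.
exists s; apply: isRFmatrix_cyclic => t; first exact: (alpha_gt1 n_min alphaP).
exact: (sole_edge_eq n_min alphaP (fPF true) (sole_s t)).
Qed.
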